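(* Let $\mathcal X$ be a measurable space and let $\Phi=\{g_1,\dots,g_d\}$ be a finite nonempty set of real-valued measurable functions on $\mathcal X$. Let $$\mathcal P=\Big\{\mu\in\mathcal M_1:\int_{\mathcal X}|f|\,d\mu<\infty\text{ and }\int_{\mathcal X}f\,d\mu\le 0\text{ for all }f\in\Phi\Big\}$$ and $$\widetilde{\mathcal P}=\Big\{\mu\in\mathcal M_1:\int_{\mathcal X}f^+\,d\mu<\infty\text{ and }\int_{\mathcal X}f\,d\mu\in[-\infty,0]\text{ for all }f\in\Phi\Big\}.$$ Then the set of e-variables for $\widetilde{\mathcal P}$ coincides with the set of e-variables for $\mathcal P$.
   Context: $\mathcal M_1$ is the set of probability measures on $\mathcal X$. An e-variable for a set $\mathcal P$ of probability measures on $\mathcal X$ is a measurable $h:\mathcal X\to[0,\infty]$ with $\int_{\mathcal X}h\,d\mu\le 1$ for all $\mu\in\mathcal P$. $f^+=\max(f,0)$. *)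

(* Defs.v *)
From mathcomp Require Import all_boot all_order all_algebra.
From mathcomp Require Import all_classical all_reals all_analysis.
(* Provides the measurable structure on [\bar R]. *)
From mathcomp Require Import measurable_realfun.

Set Implicit Arguments.
Unset Strict Implicit.
Unset Printing Implicit Defensive.

Import Order.TTheory GRing.Theory Num.Theory.
Local Open Scope classical_set_scope.
Local Open Scope ring_scope.
Local Open Scope ereal_scope.

Definition is_evar (d : measure_display) (X : measurableType d) (R : realType)
    (P : set (probability X R)) (h : X -> \bar R) : Prop :=
  [/\ measurable_fun [set: X] h,
      forall x, 0 <= h x &
      forall mu : probability X R, P mu -> \int[mu]_x h x <= 1].

Definition evars (d : measure_display) (X : measurableType d) (R : realType)
    (P : set (probability X R)) : set (X -> \bar R) :=
  [set h | is_evar P h].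

Definition constr_hyp (d : measure_display) (X : measurableType d)
    (R : realType) (Phi : set (X -> R)) : set (probability X R) :=
  [set mu : probability X R | forall f, Phi f ->
     \int[mu]_x `|f x|%:E < +oo /\ \int[mu]_x (f x)%:E <= 0].

(* The integral of [f] is by definition that of [f^\+] minus that of [f^\-],
   so with the first conjunct it is a genuine value in [-oo, +oo[. *)
Definition constr_hyp_ext (d : measure_display) (X : measurableType d)
    (R : realType) (Phi : set (X -> R)) : set (probability X R) :=
  [set mu : probability X R | forall f, Phi f ->
     \int[mu]_x (f^\+ x)%R%:E < +oo /\ \int[mu]_x (f x)%:E <= 0].

(* Main.v *)
(* Let [mu] satisfy the extended constraints and let [A n] be the set where
   every constraint is bounded by [n] in absolute value. Conditioning [mu] on
   [A n] makes all constraints integrable, but it may break those whose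
   [mu]-integral is finite. The error vector tends to 0 and lies in the span of
   finitely many vectors of truncated integrals, so a density of the form
   1_(A n) + \sum_i c_i 1_(A i) with small c_i restores exactly the integrals of
   all integrable constraints and of the constant 1. A constraint with integral
   -oo has a negative integral against this density once n is large. Hence an
   e-variable [h] for the smaller hypothesis satisfies
   (1 - e) \int_(A n) h <= 1; let n tend to infinity, then e to 0. *)

Require Import Defs.
From HB Require Import structures.
From mathcomp Require Import all_boot all_order all_algebra.
From mathcomp Require Import all_classical all_reals all_analysis.
From mathcomp Require Import measurable_realfun.
From mathcomp Require Import ring lra.

Set Implicit Arguments.
Unset Strict Implicit.
Unset Printing Implicit Defensive.

Import Order.TTheory GRing.Theory Num.Theory.
Import numFieldNormedType.Exports.
Local Open Scope classical_set_scope.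
Local Open Scope ring_scope.

(** * Linear algebra of a convergent sequence of row vectors *)

(** Ranks of prefixes are bounded by [p], so some prefix has maximal rank, and every longer prefix
    then has the same row space. *)
Lemma rowspace_sequence_finite (F : fieldType) (p : nat) (v : nat -> 'rV[F]_p) :
  exists N, forall m, (v m <= \matrix_(i < N) v i)%MS.
Proof.
pose B N : 'M[F]_(N, p) := \matrix_(i < N) v i.
have sub_B m N : (m < N)%N -> (v m <= B N)%MS.
  by move=> mN; rewrite -[v m](rowK (fun i : 'I_N => v i) (Ordinal mN)) row_sub.
pose attained r := `[< exists N, \rank (B N) = r >].
have attained0 : exists r, attained r by exists (\rank (B 0)); apply/asboolP; exists 0.
have attained_le r : attained r -> (r <= p)%N.
  by move=> /asboolP[N <-]; exact: rank_leq_col.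
case: (ex_maxnP attained0 attained_le) => _ /asboolP[N <-] rank_max.
exists N => m.
have BN : (B N <= B (maxn N m.+1))%MS.
  by apply/row_subP => i; rewrite rowK sub_B// leq_max ltn_ord.
have := rank_max (\rank (B (maxn N m.+1))) _.
rewrite (geq_leqif (mxrank_leqif_sup BN)) => BN'.
apply: (submx_trans (sub_B _ (maxn N m.+1) _)); first by rewrite leq_max ltnSn orbT.
by apply: BN'; apply/asboolP; exists (maxn N m.+1).
Qed.

(* The error [l - v n] stays in the span of finitely many [v i], a closed
   subspace on which coordinates depend continuously on the vector. *)
Lemma correct_by_small_combination (R : realType) (p : nat)
    (v : nat -> 'rV[R]_p) (l : 'rV[R]_p) :
    (forall j, v n 0 j @[n --> \oo] --> l 0 j) ->
  exists N, forall e : R, 0 < e -> \forall n \near \oo,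
    exists2 c : 'I_N -> R, \sum_i `|c i| <= e &
      l = v n + \sum_i c i *: v i.
Proof.
move=> vl; have [N vB] := rowspace_sequence_finite v.
set B := \matrix_(i < N) v i in vB.
have cvg_mul q (K : 'M[R]_(p, q)) j : (v n *m K) 0 j @[n --> \oo] --> (l *m K) 0 j.
  under eq_fun do rewrite mxE; rewrite mxE.
  by apply: (cvg_big add_continuous) => i _; apply: cvgMl; exact: vl.
(* Right multiplication by [cokermx B] vanishes exactly on the row space of [B]; it kills every
   [v n], hence also their limit. *)
have lB : (l <= B)%MS.
  rewrite submxE; apply/eqP/rowP => j; rewrite [RHS]mxE.
  have := cvg_mul _ (cokermx B) j.
  under eq_fun => n.
    have /eqP -> : v n *m cokermx B == 0 by rewrite -submxE.
    rewrite mxE; over.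
  by move=> /cvg_lim <- //; rewrite lim_cst.
exists N => e e0.
(* One fixed generalized inverse of [B] serves all [n], so the coefficients are linear in the error
   and tend to 0 with it. *)
pose c n : 'rV[R]_N := (l - v n) *m pinvmx B.
have c_to0 i : c n 0 i @[n --> \oo] --> (0 : R).
  have cE n : c n 0 i = (l *m pinvmx B) 0 i - (v n *m pinvmx B) 0 i.
    by rewrite /c mulmxBl mxE [X in _ + X]mxE.
  under eq_fun do rewrite cE.
  have -> : (0 : R) = (l *m pinvmx B) 0 i - (l *m pinvmx B) 0 i by rewrite subrr.
  exact: (cvgB (cvg_cst _) (cvg_mul _ _ i)).
have sum_to0 : \sum_i `|c n 0 i| @[n --> \oo] --> (0 : R).
  rewrite [X in _ --> X](_ : _ = \sum_(i < N) `|0 : R|); last by rewrite normr0 big1.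
  by apply: (cvg_big add_continuous) => i _; exact: (cvg_norm (c_to0 i)).
near=> n.
have cn : `|\sum_i `|c n 0 i| | <= e by near: n; exact: (cvgr0_norm_le _ sum_to0).
exists (fun i => c n 0 i); first by rewrite (le_trans _ cn)// ler_norm.
have : (l - v n <= B)%MS by rewrite addmx_sub// eqmx_opp.
move=> /mulmxKpV; rewrite mulmx_sum_row => eq_c.
rewrite -[LHS](subrK (v n)) addrC -{1}eq_c; congr (_ + _).
by apply: eq_bigr => i _; rewrite rowK.
Unshelve. all: by end_near. Qed.

(** * Probability measures given by a density *)

Section density.
Local Open Scope ereal_scope.
Context (d : measure_display) (X : measurableType d) (R : realType).
Variables (mu : probability X R) (w : X -> R).
Hypothesis mw : measurable_fun [set: X] w.
Hypothesis w_ge0 : forall x, (0 <= w x)%R.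
Hypothesis int_w : \int[mu]_x (w x)%:E = 1.

Let wE_ge0 x : 0 <= (w x)%:E. Proof. by rewrite lee_fin. Qed.

Let nu (A : set X) : \bar R := \int[mu]_(x in A) (w x)%:E.

Let nu0 : nu set0 = 0. Proof. exact: integral_set0. Qed.

Let nu_ge0 A : 0 <= nu A. Proof. by apply: integral_ge0. Qed.

Let nu_sigma_additive : semi_sigma_additive nu.
Proof. by apply: semi_sigma_additive_nng_induced => //; exact/measurable_EFinP. Qed.

HB.instance Definition _ := isMeasure.Build _ _ _ nu nu0 nu_ge0 nu_sigma_additive.
HB.instance Definition _ := Measure_isProbability.Build _ _ _ nu int_w.

(** The measure is [nu]. Its Radon-Nikodym derivative has the same integral as [w] over every
    measurable set, so the two agree almost everywhere and the change of variables formula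
    applies. *)
Lemma probability_with_density : exists rho : probability X R,
  forall f : X -> \bar R, measurable_fun [set: X] f ->
    \int[rho]_x f x = \int[mu]_x (f x * (w x)%:E).
Proof.
pose rho : probability X R := nu.
have mwE : measurable_fun [set: X] (EFin \o w) by exact/measurable_EFinP.
have rho_mu : rho `<< mu.
  apply/null_content_dominatesP => A mA muA.
  by apply: null_set_integral => //; exact: measurable_funTS.
have int_w_oo : mu.-integrable [set: X] (EFin \o w).
  apply/integrableP; split => //.
  under eq_integral do rewrite /= ger0_norm//.
  by rewrite int_w ltry.
pose g := Radon_Nikodym_SigmaFinite.f rho mu.
have gw : ae_eq mu [set: X] g (EFin \o w).
  apply: integral_ae_eq => //; first exact: Radon_Nikodym_SigmaFinite.f_integrable.
  by move=> E _ mE; rewrite -Radon_Nikodym_SigmaFinite.f_integral.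
have ge0_case (f : X -> \bar R) : measurable_fun [set: X] f -> (forall x, 0 <= f x) ->
    \int[rho]_x f x = \int[mu]_x (f x * (w x)%:E).
  move=> mf f0.
  rewrite -(Radon_Nikodym_SigmaFinite.change_of_variables rho_mu)//.
  apply: ae_eq_integral => //.
  - apply: emeasurable_funM => //.
    exact: (measurable_int mu (Radon_Nikodym_SigmaFinite.f_integrable rho_mu)).
  - exact: emeasurable_funM.
  - by apply: filterS gw => x /= /[apply] <-.
exists rho => f mf.
(* Multiplication by [w >= 0] commutes with taking positive and negative parts, so the sides agree
   part by part, even for infinite integrals. *)
rewrite integralE [RHS]integralE; congr (_ - _).
- rewrite ge0_case//; last exact: measurable_funepos.
  by apply: eq_integral => x _; rewrite !funeposE muleC maxe_pMr// mule0 muleC.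
- rewrite ge0_case//; last exact: measurable_funeneg.
  by apply: eq_integral => x _; rewrite !funenegE muleC maxe_pMr// mule0 muleN [X in - X]muleC.
Qed.

End density.

Lemma near_forall_finite_set (T : Type) (F : set_system T) (I : choiceType)
    (D : set I) (P : I -> T -> Prop) : Filter F -> finite_set D ->
    (forall i, D i -> \forall x \near F, P i x) ->
  \forall x \near F, forall i, D i -> P i x.
Proof.
move=> FF /finite_fsetP[E ->] nearP.
exact: (@filter_bigI T I E (fun i => P i) F FF).
Qed.

(** * Densities close to an indicator with prescribed integrals *)

Section correction.
Context (d : measure_display) (X : measurableType d) (R : realType).
Variables (mu : probability X R) (A : (set X)^nat).
Hypotheses (mA : forall n, measurable (A n)) (ndA : nondecreasing_seq A)
  (cupA : \bigcup_n A n = [set: X]).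

Let indic_nd m n x : (m <= n)%N -> \1_(A m) x <= \1_(A n) x :> R.
Proof.
move=> mn; rewrite !indicE ler_nat.
case: (boolP (x \in A m)) => // /set_mem Amx; rewrite mem_set//.
by have /subsetPset := ndA mn; apply.
Qed.

Let int_restr (f : X -> R) n :
    mu.-integrable [set: X] (EFin \o f) ->
  mu.-integrable [set: X] (fun x => (f x * \1_(A n) x)%:E).
Proof.
move=> intf; have := integrableS measurableT (mA n) (@subsetT _ _) intf.
by rewrite (integrable_mkcond _ (mA n)) epatch_indic.
Qed.

Let cvg_int_restr (f : X -> R) :
    mu.-integrable [set: X] (EFin \o f) ->
  fine (\int[mu]_x (f x * \1_(A n) x)%:E)%E @[n --> \oo] -->
  fine (\int[mu]_x (f x)%:E)%E.
Proof.
move=> intf; have /measurable_EFinP mf := measurable_int mu intf.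
apply/fine_cvg; rewrite fineK ?integrable_fin_num//.
apply: (@dominated_cvg _ _ _ _ _ measurableT _ _ (fun x => `|f x|%:E)) => //.
- move=> n; exact: measurable_int (int_restr n intf).
- move=> x _.
  have [n _ Anx] : (\bigcup_n A n) x by rewrite cupA.
  apply: cvg_near_cst; near=> m.
  rewrite indicE mem_set ?mulr1//.
  have nm : (n <= m)%N by near: m; exact: nbhs_infty_ge.
  by have /subsetPset := ndA nm; apply.
- exact: (integrable_norm intf).
- move=> n x _; rewrite lee_fin normrM ler_piMr// indicE.
  by case: (x \in A n); rewrite ?normr1 ?normr0.
Unshelve. all: by end_near. Qed.

(** The vectors of truncated integrals converge to the vector of full integrals by dominated
    convergence. Coefficients that correct the vectors also correct the density, since integration
    is linear. *)
Lemma near_indicator_same_integrals (Psi : set (X -> R)) (e : R) :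
    finite_set Psi ->
    (forall f, Psi f -> mu.-integrable [set: X] (EFin \o f)) -> 0 < e ->
  \forall n \near \oo, exists w : X -> R,
    [/\ measurable_fun [set: X] w,
        forall x, (1 - e) * \1_(A n) x <= w x <= (1 + e) * \1_(A n) x &
        forall f, Psi f -> (\int[mu]_x (f x * w x)%:E = \int[mu]_x (f x)%:E)%E].
Proof.
move=> /finite_seqP[s ->] intPsi e0.
have ints (j : 'I_(size s)) : mu.-integrable [set: X] (EFin \o s`_j).
  by apply: intPsi => /=; exact: mem_nth.
pose v n : 'rV[R]_(size s) :=
  \row_j fine (\int[mu]_x (s`_j x * \1_(A n) x)%:E)%E.
pose l : 'rV[R]_(size s) := \row_j fine (\int[mu]_x (s`_j x)%:E)%E.
have vl j : v n 0 j @[n --> \oo] --> l 0 j.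
  by rewrite mxE; under eq_fun do rewrite mxE; exact: cvg_int_restr.
have [N small] := correct_by_small_combination vl.
near=> n.
have [c ce lE] : exists2 c : 'I_N -> R, \sum_i `|c i| <= e &
    l = v n + \sum_i c i *: v i by near: n; exact: small.
(* This puts each [A i] with [i < N] inside [A n], so the correction vanishes off [A n]. *)
have Nn : (N <= n)%N by near: n; exact: nbhs_infty_ge.
exists (fun x => \1_(A n) x + \sum_(i < N) c i * \1_(A i) x); split.
- apply: measurable_funD; first exact: measurable_indic.
  by apply: measurable_sum => i; apply: measurable_funM => //; exact: measurable_indic.
- move=> x; set corr := \sum_(i < N) _.
  have : `|corr| <= e * \1_(A n) x.
    apply: le_trans (ler_norm_sum _ _ _) _.
    apply: le_trans (_ : \sum_(i < N) `|c i| * \1_(A n) x <= _).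
      apply: ler_sum => i _; rewrite normrM ler_wpM2l// ger0_norm//.
      by apply: indic_nd; rewrite (leq_trans (ltnW (ltn_ord i))).
    by rewrite -mulr_suml ler_wpM2r.
  by rewrite ler_norml => /andP[? ?]; rewrite mulrBl mulrDl !mul1r; lra.
- move=> f /= /(nthP 0)[j0 j0s <-]; pose j := Ordinal j0s.
  have intsj n' : mu.-integrable [set: X] (fun x => (s`_j x * \1_(A n') x)%:E).
    exact/int_restr/ints.
  transitivity (\int[mu]_x ((s`_j x * \1_(A n) x)%:E +
      \sum_(i < N) (c i)%:E * (s`_j x * \1_(A i) x)%:E))%E.
    apply: eq_integral => x _; rewrite mulrDr mulr_sumr EFinD -sumEFin.
    by congr (_ + _)%E; apply: eq_bigr => i _; rewrite mulrCA EFinM.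
  rewrite integralD//; last by apply: integrable_sum => // i _; exact: integrableZl.
  rewrite integral_sum//; last by move=> i; exact: integrableZl.
  have finE n' : (\int[mu]_x (s`_j x * \1_(A n') x)%:E = (v n' 0 j)%:E)%E.
    by rewrite mxE fineK// integrable_fin_num.
  rewrite finE; under eq_bigr do rewrite integralZl// finE -EFinM.
  rewrite sumEFin -EFinD -[RHS]fineK ?integrable_fin_num//; last exact: (ints j).
  congr (_%:E).
  have -> : fine (\int[mu]_x (s`_j0 x)%:E)%E = l 0 j by rewrite mxE.
  by rewrite lE [RHS]mxE summxE; congr (_ + _); apply: eq_bigr => i _; rewrite [RHS]mxE.
Unshelve. all: by end_near. Qed.

End correction.

(** * From the small hypothesis to the extended one *)

(** The loss factor [1 - e] is the lower bound on [A n] of a density that moves [mu] into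
    [constr_hyp Phi]; [e < 1] keeps this density nonnegative. *)
Lemma evar_bound_on_extension (d : measure_display) (X : measurableType d)
    (R : realType) (Phi : set (X -> R)) (h : X -> \bar R) (mu : probability X R)
    (e : R) :
    finite_set Phi -> (forall f, Phi f -> measurable_fun [set: X] f) ->
    is_evar (constr_hyp Phi) h -> constr_hyp_ext Phi mu -> 0 < e < 1 ->
  ((1 - e)%:E * \int[mu]_x h x <= 1)%E.
Proof.
move=> finPhi mPhi [mh h0 evh] Pmu /andP[e0 e1].
pose A n : set X := \bigcap_(f in Phi) f @^-1` `[- n%:R, n%:R].
have AP n x : A n x <-> forall f, Phi f -> `|f x| <= n%:R.
  by split=> Anx f /Anx; rewrite /= in_itv/= ler_norml.
have mA n : measurable (A n).
  apply: fin_bigcap_measurable => // f Phif.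
  by rewrite -[X in measurable X]setTI; exact: mPhi.
have ndA : nondecreasing_seq A.
  move=> m n mn; apply/subsetPset => x /AP Amx; apply/AP => f /Amx.
  by move=> /le_trans; apply; rewrite ler_nat.
(* Finiteness of [Phi] gives one bound for all values [f x] at a given [x]. *)
have cupA : \bigcup_n A n = [set: X].
  apply/seteqP; split=> // x _.
  have /filter_ex[n Anx] : \forall n \near \oo, forall f, Phi f -> `|f x| <= n%:R.
    by apply: near_forall_finite_set => // f _; exact: nbhs_infty_ger.
  by exists n => //; apply/AP.
have cvg_A (g : X -> \bar R) : measurable_fun [set: X] g -> (forall x, 0 <= g x)%E ->
    (\int[mu]_(x in A n) g x)%E @[n --> \oo] --> (\int[mu]_x g x)%E.
  move=> mg g0; rewrite -cupA; apply: ge0_nondecreasing_set_cvg_integral => //.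
  by move=> n; exact: measurable_funTS.
have int_fneg f : Phi f -> ~ mu.-integrable [set: X] (EFin \o f) ->
    (\int[mu]_x (f^\- x)%:E = +oo)%E.
  move=> Phif; have [fpos_fin _] := Pmu f Phif.
  apply: contra_notP => /eqP; rewrite -ltey => fneg_fin.
  have mf := mPhi f Phif.
  apply/integrableP; split; first exact/measurable_EFinP.
  under eq_integral => x _ do rewrite /= -[`|f x|]/((Num.norm \o f) x) -funrposDneg EFinD.
  rewrite ge0_integralD//.
  - by rewrite lte_add_pinfty.
  - by move=> x _; rewrite lee_fin funrpos_ge0.
  - by apply/measurable_EFinP; exact: measurable_funrpos.
  - by move=> x _; rewrite lee_fin funrneg_ge0.
  - by apply/measurable_EFinP; exact: measurable_funrneg.
(* The left side is finite and will bound the positive part of [f * w]; the right side tends to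
   infinity and will bound the negative part from below. *)
have neg_dominates : \forall n \near \oo, forall f,
    (Phi `\` [set f : X -> R | mu.-integrable [set: X] (EFin \o f)]) f ->
    ((1 + e)%:E * \int[mu]_x (f^\+ x)%:E <=
     (1 - e)%:E * \int[mu]_(x in A n) (f^\- x)%:E)%E.
  apply: near_forall_finite_set => [|f [Phif nintf]]; first exact: finite_setD.
  have [fpos_fin _] := Pmu f Phif.
  have mfneg : measurable_fun [set: X] (fun x => (f^\- x)%:E).
    by apply/measurable_EFinP; apply: measurable_funrneg; exact: mPhi.
  have fneg_to_oo := cvg_A _ mfneg (fun x => _ : (0 <= (f^\- x)%:E)%E).
  rewrite int_fneg// in fneg_to_oo.
  near=> n.
  rewrite -lee_pdivrMl ?subr_gt0// -[X in (_ * (_ * X))%E]fineK -?EFinM; last first.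
    by rewrite ge0_fin_numE// integral_ge0// => x _; rewrite lee_fin funrpos_ge0.
  near: n; apply: (cvgey_ge (fneg_to_oo _)) => x.
  by rewrite lee_fin funrneg_ge0.
(* The constant 1 joins the integrable constraints so that [w] has total mass 1. *)
have same_int : \forall n \near \oo, exists w : X -> R,
    [/\ measurable_fun [set: X] w,
        forall x, (1 - e) * \1_(A n) x <= w x <= (1 + e) * \1_(A n) x &
        forall f, ([set cst 1] `|`
          (Phi `&` [set f : X -> R | mu.-integrable [set: X] (EFin \o f)])) f ->
          (\int[mu]_x (f x * w x)%:E = \int[mu]_x (f x)%:E)%E].
  apply: near_indicator_same_integrals => //.
    by rewrite finite_setU; split; [exact: finite_set1|exact: finite_setIl].
  move=> f [->|[]//].
  exact: finite_measure_integrable_cst.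
suff bound_A : \forall n \near \oo, ((1 - e)%:E * \int[mu]_(x in A n) h x <= 1)%E.
  apply: (cvge_to_le _ bound_A).
  by apply: cvgeZl => //; exact: cvg_A.
apply: filterS2 neg_dominates same_int => n dom [w [mw w_bounds int_w]].
have w_ge0 x : 0 <= w x.
  have /andP[+ _] := w_bounds x; apply: le_trans.
  by rewrite mulr_ge0// subr_ge0 ltW.
have w_le x : w x <= 1 + e.
  have /andP[_ /le_trans] := w_bounds x; apply.
  by rewrite ler_piMr// ?addr_ge0 ?ltW// indicE; case: (_ \in _).
have w_outside x : ~ A n x -> w x = 0.
  move=> nAx; have := w_bounds x; rewrite indicE memNset// !mulr0.
  by rewrite -eq_le eq_sym => /eqP.
have w1 : (\int[mu]_x (w x)%:E = 1)%E.
  transitivity (\int[mu]_x (cst 1 x * w x)%:E)%E.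
    by apply: eq_integral => x _; rewrite mul1r.
  rewrite int_w; last by left.
  rewrite -[RHS](probability_setT mu) -[RHS]mul1e; exact: (integral_cst mu measurableT 1%:E).
have [rho rhoE] := probability_with_density mw w_ge0 w1.
have w_ge x : A n x -> 1 - e <= w x.
  by move=> Anx; have /andP[+ _] := w_bounds x; rewrite indicE mem_set// mulr1.
(* Used twice: with [g] the negative part of a nonintegrable constraint, and with [g] equal to
   [h]. *)
have lower (g k : X -> \bar R) :
    measurable_fun [set: X] g -> (forall x, 0 <= g x)%E ->
    measurable_fun [set: X] k -> (forall x, 0 <= k x)%E ->
    (forall x, A n x -> (1 - e)%:E * g x <= k x)%E ->
    ((1 - e)%:E * \int[mu]_(x in A n) g x <= \int[mu]_x k x)%E.
  move=> mg g0 mk k0 gk; have e1' : (0 <= (1 - e)%:E)%E by rewrite lee_fin subr_ge0 ltW.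
  rewrite -ge0_integralZl//; last exact: measurable_funTS.
  apply: (@le_trans _ _ (\int[mu]_(x in A n) k x)%E).
    apply: ge0_le_integral => //.
    - by move=> x _; exact: mule_ge0.
    - by apply: measurable_funeM; exact: measurable_funTS.
    - exact: measurable_funTS.
  exact: ge0_subset_integral.
have mfE f : Phi f -> measurable_fun [set: X] (EFin \o f).
  by move=> /mPhi /measurable_EFinP.
have Prho : constr_hyp Phi rho.
  move=> f Phif; have mf := mPhi f Phif; split.
    rewrite rhoE; last by apply/measurable_EFinP; exact: measurableT_comp.
    under eq_integral do rewrite -EFinM.
    (* On [A n] the factors are at most [n] and [1 + e]; off [A n] the density is 0. *)
    apply: (@le_lt_trans _ _ (\int[mu]_x (cst (n%:R * (1 + e))%:E x))%E); last first.
      by rewrite integral_cst// ltey_eq fin_numM// fin_num_measure.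
    apply: ge0_le_integral => //.
    - by move=> x _; rewrite lee_fin mulr_ge0.
    - by apply/measurable_EFinP/measurable_funM => //; exact: measurableT_comp.
    - move=> x _; rewrite lee_fin; have [/AP Anx|nAx] := pselect (A n x).
        by rewrite ler_pM// Anx.
      by rewrite w_outside// mulr0 mulr_ge0// addr_ge0// ltW.
  rewrite rhoE; last exact: mfE.
  under eq_integral do rewrite -EFinM.
  have [intf|nintf] := pselect (mu.-integrable [set: X] (EFin \o f)).
    by rewrite int_w; [have [] := Pmu f Phif|right].
  have mfw : measurable_fun [set: X] (fun x => (f x * w x)%:E).
    by apply/measurable_EFinP/measurable_funM.
  (* It remains to bound the positive part of [f * w] by its negative part, in integral; [dom] is
     the middle link. *)
  rewrite integralE sube_le0.
  apply: (le_trans (le_trans _ (dom f (conj Phif nintf)))).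
    rewrite -ge0_integralZl//=.
    - apply: ge0_le_integral => //.
      + exact: measurable_funepos.
      + apply: measurable_funeM.
        by apply/measurable_EFinP; exact: measurable_funrpos.
      + move=> x _; rewrite funeposE -EFin_max -EFinM lee_fin /funrpos.
        rewrite ge_max mulr_ge0 ?addr_ge0 ?le_max ?lexx ?orbT ?(ltW e0)// andbT.
        apply: (@le_trans _ _ (Num.max (f x) 0 * w x)).
          by rewrite ler_wpM2r// le_max lexx.
        by rewrite mulrC ler_wpM2r// le_max lexx orbT.
    - by apply/measurable_EFinP; exact: measurable_funrpos.
    - by move=> x _; rewrite lee_fin funrpos_ge0.
    - by rewrite lee_fin addr_ge0// ltW.
  apply: lower => //.
  - by apply/measurable_EFinP; exact: measurable_funrneg.
  - by move=> x; rewrite lee_fin funrneg_ge0.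
  - exact: measurable_funeneg.
  - move=> x Anx; rewrite funenegE -EFinN -EFin_max -EFinM lee_fin /funrneg.
    rewrite maxr_pMr ?subr_ge0 ?(ltW e1)// mulr0 ge_max !le_max lexx orbT andbT.
    have [fx0|fx0] := leP (- f x) 0.
      by rewrite mulr_ge0_le0 ?subr_ge0 ?(ltW e1)// orbT.
    by rewrite -mulNr mulrC ler_wpM2l ?w_ge// ltW.
apply: le_trans (evh _ Prho); rewrite rhoE//.
apply: lower => //.
- by apply: emeasurable_funM => //; exact/measurable_EFinP.
- by move=> x; rewrite mule_ge0// lee_fin.
- by move=> x Anx; rewrite muleC lee_wpmul2l// lee_fin w_ge.
Unshelve. all: by end_near. Qed.

Theorem theorem9p2 (d : measure_display) (X : measurableType d) (R : realType)
    (Phi : set (X -> R))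
    (Phi_fin : finite_set Phi)
    (Phi_nonempty : Phi !=set0)
    (Phi_meas : forall f : X -> R, Phi f -> measurable_fun [set: X] f) :
  evars (constr_hyp_ext Phi) = evars (constr_hyp Phi).
Proof.
apply/seteqP; split=> h [mh h0 evh]; split=> // mu Pmu.
  (* The extended hypothesis contains the original one, because the positive part of [f] is at most
     its absolute value. *)
  apply: evh => f Phif; have [abs_fin int_le0] := Pmu f Phif; split=> //.
  have mf := Phi_meas f Phif.
  apply: le_lt_trans abs_fin; apply: ge0_le_integral => //.
  - by move=> x _; rewrite lee_fin funrpos_ge0.
  - by apply/measurable_EFinP; exact: measurable_funrpos.
  - by apply/measurable_EFinP; exact: measurableT_comp.
  - by move=> x _; rewrite lee_fin /funrpos ge_max ler_norm normr_ge0.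
have bound e : 0 < e < 1 -> ((1 - e)%:E * \int[mu]_x h x <= 1)%E.
  exact: (evar_bound_on_extension Phi_fin Phi_meas (And3 mh h0 evh) Pmu).
(* The bound at [e = 1/2] already excludes an infinite integral. *)
have : (\int[mu]_x h x \is a fin_num)%E.
  rewrite ge0_fin_numE ?integral_ge0// ltey; apply/eqP => int_oo.
  have /bound : 0 < (2^-1 : R) < 1 by lra.
  by rewrite int_oo gt0_muley ?leye_eq// lte_fin; lra.
move=> /fineK intE; rewrite -intE in bound *.
move: (fine _) bound {intE} => r bound.
rewrite lee_fin leNgt; apply/negP => r1.
have r0 : 0 < r by apply: lt_trans r1.
(* Chosen so that [(1 - e) * r = (r + 1) / 2], which exceeds 1 when [r > 1]. *)
pose e := (r - 1) / (2 * r).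
have er : e * r = (r - 1) / 2 by rewrite /e; field; lra.
have e0 : 0 < e by rewrite divr_gt0; lra.
have e1 : e < 1 by rewrite ltr_pdivrMr; lra.
have /bound : 0 < e < 1 by rewrite e0.
by rewrite -EFinM lee_fin mulrBl er mul1r; lra.
Qed.
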